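(* Let $\Sigma_V,\Sigma_E$ be label sets and $\alpha:\Sigma_V\to(0,+\infty)$. Let $G$ be the set of graphs with vertex labels in $\Sigma_V$ and edge labels in $\Sigma_E$, where isomorphic graphs are regarded as the same element of $G$. Let $\subseteq_i$ be the induced-subgraph-isomorphic relation on $G$, and define $s_{GV\alpha}:G\to[0,\infty)$ by $s_{GV\alpha}(g)=0$ if $V=\emptyset$ and otherwise $s_{GV\alpha}(g)=\sum_{v\in V}\alpha(\ell_V(v))$ for $g=(V,E,\ell_V,\ell_E)$. Then $(G,\subseteq_i,s_{GV\alpha})$ is a Maximum Common Subelement (MCS) Model.
   Context: A graph is a 4-tuple $g=(V,E,\ell_V,\ell_E)$ with $V$ a finite set, $E\subseteq[V]^2$ (the set of 2-element subsets of $V$), $\ell_V:V\to\Sigma_V$, $\ell_E:E\to\Sigma_E$; it is empty if $V=\emptyset$. $g'=(V',E',\ell'_V,\ell'_E)$ is a subgraph of $g$ if $V'\subseteq V$, $E'\subseteq E\cap[V']^2$, and $\ell'_V,\ell'_E$ agree with $\ell_V,\ell_E$ on $V',E'$; it is an induced subgraph if moreover $E'=E\cap[V']^2$. An isomorphism between $g_1$ and $g_2$ is a bijection $\phi:V_1\to V_2$ with $E_2=\{\{\phi(u),\phi(v)\}:\{u,v\}\in E_1\}$ preserving vertex and edge labels. $g'\subseteq_i g$ means some induced subgraph of $g$ is isomorphic to $g'$. For a partial order $\preccurlyeq$ on $X$ and $X'\subseteq X$, $cs(X')=\{x\in X: x\preccurlyeq y\ \forall y\in X'\}$. A size function on $(X,\preccurlyeq)$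 is $s:X\to[0,\infty)$ with (S1) $x_1\preccurlyeq x_2\Rightarrow s(x_1)\le s(x_2)$ and (S2) $x_1\preccurlyeq x_2$, $s(x_1)=s(x_2)\Rightarrow x_1=x_2$. An MCS Model is a triple $(X,\preccurlyeq,s)$ with $\preccurlyeq$ a partial order on $X$, $s$ a size function, and (A1) for all $x_1,x_2$, $cs(\{x_1,x_2\})\ne\emptyset$ and $\{s(x)\mid x\in cs(\{x_1,x_2\})\}$ has a maximum; (A2) for all $x_1,x_2,x$ with $x_1,x_2\preccurlyeq x$ there is $x_{12}\in cs(\{x_1,x_2\})$ with $s(x)\ge s(x_1)+s(x_2)-s(x_{12})$. *)

(* Defs.v *)
From Stdlib Require Relation_Definitions.
From mathcomp Require Import all_boot all_order all_algebra.
From mathcomp Require Import boolp classical_sets reals.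

Set Implicit Arguments.
Unset Strict Implicit.
Unset Printing Implicit Defensive.

Import Order.TTheory GRing.Theory Num.Theory.
Local Open Scope ring_scope.

Section MCSModel.
Variables (R : realType) (X : Type) (le : X -> X -> Prop) (s : X -> R).

(* Subsets of X are plain predicates: the universe of MathComp-Analysis' [set]
   is too small to contain a type of all finite graphs. *)
Definition cs (A : X -> Prop) (x : X) : Prop := forall y, A y -> le x y.

Definition cs2 (x1 x2 : X) : X -> Prop := cs (fun y => y = x1 \/ y = x2).

Definition cs2_sizes (x1 x2 : X) : set R :=
  fun r => exists2 x, cs2 x1 x2 x & r = s x.

Record is_size_function : Prop := IsSizeFunction {
  size_ge0 : forall x, 0 <= s x ;
  size_S1 : forall x1 x2, le x1 x2 -> s x1 <= s x2 ;
  size_S2 : forall x1 x2, le x1 x2 -> s x1 = s x2 -> x1 = x2 }.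

Record MCS_model : Prop := MCSModel {
  MCS_order : Relation_Definitions.order X le ;
  MCS_size : is_size_function ;
  MCS_A1 : forall x1 x2,
    (exists x, cs2 x1 x2 x) /\
    (exists2 M, cs2_sizes x1 x2 M & ubound (cs2_sizes x1 x2) M) ;
  MCS_A2 : forall x1 x2 x, le x1 x -> le x2 x ->
    exists2 x12, cs2 x1 x2 x12 & s x1 + s x2 - s x12 <= s x }.

End MCSModel.

Section Graphs.
Variables SigmaV SigmaE : Type.

Record graph := Graph {
  vert : finType ;
  edge : {set {set vert}} ;
  edge_card : forall e, e \in edge -> #|e| = 2%N ;
  vlab : vert -> SigmaV ;
  elab : {e : {set vert} | e \in edge} -> SigmaE }.

Record is_isom (g1 g2 : graph) (phi : vert g1 -> vert g2) : Prop := IsIsom {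
  isom_bij : bijective phi ;
  isom_edge : edge g2 = [set phi @: e | e : {set vert g1} in edge g1] ;
  isom_vlab : forall u, vlab (phi u) = vlab u ;
  isom_elab : forall (e1 : {e | e \in edge g1}) (e2 : {e | e \in edge g2}),
    sval e2 = phi @: sval e1 -> elab e2 = elab e1 }.

Definition graph_iso (g1 g2 : graph) : Prop :=
  exists phi : vert g1 -> vert g2, is_isom phi.

Section Induced.
Variables (g : graph) (W : {set vert g}).

Definition induced_vert : finType := {x : vert g | x \in W}.

Definition induced_edge : {set {set induced_vert}} :=
  [set e : {set induced_vert} | val @: e \in edge g].

Lemma induced_edgeP e : e \in induced_edge -> val @: e \in edge g.
Proof. by rewrite inE. Qed.

Lemma induced_edge_card e : e \in induced_edge -> #|e| = 2%N.
Proof.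
by move=> /induced_edgeP/edge_card <-; rewrite card_imset //; apply: val_inj.
Qed.

Definition induced : graph := @Graph induced_vert induced_edge
  induced_edge_card
  (fun u => vlab (val u))
  (fun e => elab (exist _ (val @: sval e) (induced_edgeP (svalP e)))).

(* Seen in g, the edge set of [induced] is the intersection of E with [W]^2. *)
Lemma induced_edgeE :
  [set val @: e | e : {set induced_vert} in induced_edge]
  = [set e in edge g | e \subset W].
Proof.
apply/finset.setP=> e; rewrite inE; apply/imsetP/andP=> [[e' He' ->]|[He sub]].
  split; first exact: induced_edgeP.
  by apply/fintype.subsetP=> _ /imsetP[x _ ->]; apply: (valP x).
have E : e = val @: [set x : induced_vert | val x \in e].
  apply/finset.setP=> x; apply/idP/imsetP=> [xe|[y yE ->]]; last by rewrite inE in yE.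
  have xW := fintype.subsetP sub _ xe.
  by exists (exist _ x xW); rewrite ?inE.
by exists [set x : induced_vert | val x \in e]; rewrite // inE -E.
Qed.

End Induced.

Definition induced_sub (g' g : graph) : Prop :=
  exists W : {set vert g}, graph_iso (induced W) g'.

(* Graphs up to isomorphism are represented by their isomorphism classes.
   [induced_le_class] and [s_GV_class] show that [induced_le] and [s_GV] do not
   depend on the representatives. *)
Definition is_iso_class (C : graph -> Prop) : Prop := exists g, C = graph_iso g.

Definition G := {C : graph -> Prop | is_iso_class C}.

Definition iso_class (g : graph) : G :=
  exist _ (graph_iso g) (ex_intro _ g (erefl (graph_iso g))).

Definition repr (C : G) : graph := sval (cid (svalP C)).

Definition induced_le (C1 C2 : G) : Prop :=
  exists g1 g2, [/\ sval C1 g1, sval C2 g2 & induced_sub g1 g2].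

Section Size.
Variables (R : realType) (alpha : SigmaV -> R).

(* The sum is 0 on the empty graph. *)
Definition graph_size (g : graph) : R := \sum_(v : vert g) alpha (vlab v).

Definition s_GV (C : G) : R := graph_size (repr C).

End Size.

Record is_embedding (g h : graph) (f : vert g -> vert h) : Prop := IsEmbedding {
  embed_inj : injective f ;
  embed_edge : forall e : {set vert g}, (f @: e \in edge h) = (e \in edge g) ;
  embed_vlab : forall u, vlab (f u) = vlab u ;
  embed_elab : forall (e1 : {e | e \in edge g}) (e2 : {e | e \in edge h}),
    sval e2 = f @: sval e1 -> elab e2 = elab e1 }.

Lemma elab_eq (g : graph) (e1 e2 : {e | e \in edge g}) :
  sval e1 = sval e2 -> elab e1 = elab e2.
Proof. by move=> /val_inj ->. Qed.

Lemma is_isomP (g h : graph) (f : vert g -> vert h) :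
  is_isom f <-> bijective f /\ is_embedding f.
Proof.
split=> [[bf ef vf lf]|[bf [_ ef vf lf]]]; split=> //.
- split=> //; first exact: bij_inj.
  by move=> e; rewrite ef mem_imset //; apply/imset_inj/bij_inj.
- case: bf => k fK kK; apply/finset.setP=> e; apply/idP/imsetP=> [He|[e' He' ->]].
    have E : e = f @: (k @: e).
      by rewrite -imset_comp (eq_imset _ (g := id)) ?imset_id.
    by exists (k @: e); rewrite // -ef -E.
  by rewrite ef.
Qed.

Lemma embedding_comp (g h k : graph) (f : vert g -> vert h)
    (f' : vert h -> vert k) :
  is_embedding f -> is_embedding f' -> is_embedding (f' \o f).
Proof.
move=> [i e v l] [i' e' v' l']; split.
- exact: inj_comp.
- by move=> d; rewrite imset_comp e' e.
- by move=> u /=; rewrite v' v.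
- move=> e1 e2; rewrite imset_comp => E.
  have H : f @: sval e1 \in edge h by rewrite e (svalP e1).
  by rewrite (l' (exist (fun d => d \in edge h) _ H)) // (l e1).
Qed.

Lemma isom_refl g : graph_iso g g.
Proof.
exists id; apply/is_isomP; split; first by exists id.
split=> //; first by move=> e; rewrite imset_id.
by move=> e1 e2; rewrite imset_id; apply: elab_eq.
Qed.

Lemma isom_sym g h : graph_iso g h -> graph_iso h g.
Proof.
move=> [f /is_isomP [[k fK kK] [i e v l]]].
have fkK (d : {set vert h}) : f @: (k @: d) = d.
  by rewrite -imset_comp (eq_imset _ (g := id)) ?imset_id.
exists k; apply/is_isomP; split; first by exists f.
split; first exact: can_inj kK.
- by move=> d; rewrite -e fkK.
- by move=> u; rewrite -v kK.
- by move=> e1 e2 E; apply/esym/l; rewrite E fkK.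
Qed.

Lemma isom_trans g h k : graph_iso g h -> graph_iso h k -> graph_iso g k.
Proof.
move=> [f /is_isomP [b e]] [f' /is_isomP [b' e']].
exists (f' \o f); apply/is_isomP; split; first exact: bij_comp.
exact: embedding_comp.
Qed.

Lemma iso_class_eq g h : iso_class g = iso_class h <-> graph_iso g h.
Proof.
split=> [/(congr1 sval) /= ->|gh]; first exact: isom_refl.
apply: eq_exist => /=; apply/funext=> k; apply/propext; split.
  by apply: isom_trans; apply: isom_sym.
exact: isom_trans.
Qed.

Lemma reprK C : iso_class (repr C) = C.
Proof.
have : sval C = graph_iso (repr C) by apply: (svalP (cid (svalP C))).
by case: C (repr C) => D HD r /= E; apply: eq_exist.
Qed.

Lemma repr_iso_class g : graph_iso (repr (iso_class g)) g.
Proof. by apply/iso_class_eq; rewrite reprK. Qed.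

Lemma induced_subP g h :
  induced_sub g h <-> exists f : vert g -> vert h, is_embedding f.
Proof.
have valE (W : {set vert h}) :
    is_embedding (val : vert (induced W) -> vert h).
  split=> //; first exact: val_inj.
    by move=> e; rewrite /= inE.
  by move=> e1 e2 E; apply: elab_eq.
split=> [[W /isom_sym [f /is_isomP [_ ef]]]|[f ef]].
  by exists (val \o f); apply: embedding_comp ef (valE W).
pose W := f @: [set: vert g]; exists W; apply: isom_sym.
have fW u : f u \in W by apply: imset_f.
pose f' (u : vert g) : vert (induced W) := exist _ (f u) (fW u).
have f'E (e : {set vert g}) : val @: (f' @: e) = f @: e.
  by rewrite -imset_comp; apply: eq_imset.
have i' : injective f' by move=> x y /(congr1 val) /(embed_inj ef).
exists f'; apply/is_isomP; split.
  apply: inj_card_bij => //.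
  by rewrite card_sig card_imset ?cardsT //; apply: embed_inj ef.
split=> //.
- by move=> e; rewrite inE f'E (embed_edge ef).
- by move=> u; apply: (embed_vlab ef).
- move=> e1 e2 E /=; apply: (embed_elab ef) => /=.
  by rewrite E f'E.
Qed.

Lemma induced_le_class g h :
  induced_le (iso_class g) (iso_class h) <-> induced_sub g h.
Proof.
split=> [[g1 [h1 [/= [f /is_isomP [_ ef]] hh1 /induced_subP [k ek]]]]|gh].
  have [f' /is_isomP [_ ef']] := isom_sym hh1.
  apply/induced_subP; exists (f' \o (k \o f)).
  exact: embedding_comp (embedding_comp ef ek) ef'.
by exists g, h; split=> //=; apply: isom_refl.
Qed.

Lemma graph_size_isom (R : realType) (alpha : SigmaV -> R) g h :
  graph_iso g h -> graph_size alpha g = graph_size alpha h.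
Proof.
move=> [f [b _ v _]]; rewrite /graph_size (reindex f) /=; last exact: onW_bij.
by apply: eq_bigr => u _; rewrite v.
Qed.

Lemma s_GV_class (R : realType) (alpha : SigmaV -> R) g :
  s_GV alpha (iso_class g) = graph_size alpha g.
Proof. exact/graph_size_isom/repr_iso_class. Qed.

End Graphs.

(* Main.v *)
(** Everything is transported along embeddings: a common induced subgraph of
    [g1] and [g2] is, up to isomorphism, spanned by one of the finitely many
    vertex sets of [g1], so the sizes of common subgraphs have a maximum (A1).
    If [g1] and [g2] embed in [g] with images [W1] and [W2], then the subgraph
    of [g] induced by the intersection of [W1] and [W2] embeds in both, and
    (A2) is inclusion-exclusion for the weight of [W1] and [W2].  Antisymmetry
    and (S2) hold because an embedding between graphs with equally many
    vertices, or of equal positive weight, is onto. *)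
Require Import Defs.
From mathcomp Require Import all_boot all_order all_algebra.
From mathcomp Require Import boolp classical_sets reals.

Set Implicit Arguments.
Unset Strict Implicit.
Unset Printing Implicit Defensive.

Import Order.TTheory GRing.Theory Num.Theory.
Local Open Scope ring_scope.

(** * Embeddings and the order on isomorphism classes *)

Section Embeddings.
Variables SigmaV SigmaE : Type.
Implicit Types g h k : graph SigmaV SigmaE.

Lemma embedding_id g : is_embedding (@id (vert g)).
Proof.
split=> // [e|e1 e2]; rewrite imset_id //.
exact: elab_eq.
Qed.

Lemma embedding_val g (W : {set vert g}) :
  is_embedding (val : vert (induced W) -> vert g).
Proof.
split=> //; first exact: val_inj.
- by move=> e; rewrite /= inE.
- by move=> e1 e2 E; apply: elab_eq.
Qed.

(** Edges and labels can be compared after pushing everything into [k], because [f] reflects edges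
    as well as preserving them. *)
Lemma embedding_cancel g h k (f : vert h -> vert k) (u : vert g -> vert h) :
  is_embedding f -> is_embedding (f \o u) -> is_embedding u.
Proof.
move=> [fi fe fv fl] [fui fue fuv ful]; split.
- exact: inj_compr fui.
- by move=> e; rewrite -fe -imset_comp fue.
- by move=> x; rewrite -fv -fuv.
- move=> e1 e2 E.
  have fe2 : f @: sval e2 \in edge k by rewrite fe (svalP e2).
  rewrite -(fl e2 (exist (fun d => d \in edge k) _ fe2)) //.
  by apply: ful; rewrite /= E -imset_comp.
Qed.

Lemma embedding_iso g h (f : vert g -> vert h) :
  is_embedding f -> (#|vert h| <= #|vert g|)%N -> graph_iso g h.
Proof.
move=> ef le_hg; exists f; apply/is_isomP; split=> //.
exact: inj_card_bij (embed_inj ef) le_hg.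
Qed.

Lemma induced_sub_refl g : induced_sub g g.
Proof. by apply/induced_subP; exists id; apply: embedding_id. Qed.

Lemma induced_sub_trans g h k :
  induced_sub g h -> induced_sub h k -> induced_sub g k.
Proof.
move=> /induced_subP[f ef] /induced_subP[f' ef'].
by apply/induced_subP; exists (f' \o f); apply: embedding_comp.
Qed.

Lemma induced_sub_antisym g h :
  induced_sub g h -> induced_sub h g -> graph_iso g h.
Proof.
move=> /induced_subP[f ef] /induced_subP[k ek].
exact: embedding_iso ef (leq_card k (embed_inj ek)).
Qed.

Lemma induced_sub_induced g (W : {set vert g}) : induced_sub (induced W) g.
Proof. by exists W; apply: isom_refl. Qed.

(** Choosing a preimage under [f] for each vertex of [W] gives a map [u] with [f \o u = val];
    cancelling [f] from the embedding [val] makes [u] an embedding. *)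
Lemma induced_sub_image g h (f : vert g -> vert h) (W : {set vert h}) :
  is_embedding f -> W \subset f @: [set: vert g] -> induced_sub (induced W) g.
Proof.
move=> ef /fintype.subsetP sWf.
have preim (w : vert (induced W)) : {x | f x = val w}.
  by apply: cid; have /imsetP[x _ ->] := sWf _ (valP w); exists x.
pose u w := sval (preim w).
apply/induced_subP; exists u; apply: (embedding_cancel ef).
suff -> : f \o u = val by apply: embedding_val.
by apply/funext=> w /=; rewrite (svalP (preim w)).
Qed.

(** Provides a common subgraph of any two graphs, so that the search for a largest one has a
    starting candidate. *)
Lemma induced_set0_sub g h : induced_sub (induced (finset.set0 : {set vert g})) h.
Proof.
have F (x : vert (induced (finset.set0 : {set vert g}))) : False.
  by have := valP x; rewrite inE.
apply/induced_subP; exists (fun x => False_rect _ (F x)).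
have E (e : {set vert (induced (finset.set0 : {set vert g}))}) :
    e = finset.set0.
  by apply/finset.setP=> x; case: (F x).
split=> [x|e|x|e1]; [by case: (F x)| |by case: (F x)|].
- rewrite (E e) imset0.
  (* Both memberships are false: an edge has two vertices, and the only vertex set here is empty. *)
  by apply/idP/idP=> /edge_card; rewrite cards0.
- by have := edge_card (svalP e1); rewrite (E (sval e1)) cards0.
Qed.

Lemma induced_leE (C D : G SigmaV SigmaE) :
  induced_le C D <-> induced_sub (Defs.repr C) (Defs.repr D).
Proof. by rewrite -induced_le_class !Defs.reprK. Qed.

Lemma induced_le_order :
  Relation_Definitions.order _ (@induced_le SigmaV SigmaE).
Proof.
split.
- by move=> C; apply/induced_leE/induced_sub_refl.
- move=> C D K /induced_leE CD /induced_leE DK.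
  exact/induced_leE/(induced_sub_trans CD DK).
- move=> C D /induced_leE CD /induced_leE DC.
  rewrite -(Defs.reprK C) -(Defs.reprK D); apply/iso_class_eq.
  exact: induced_sub_antisym.
Qed.

Lemma cs2_iso_class g (C D : G SigmaV SigmaE) :
  induced_sub g (Defs.repr C) -> induced_sub g (Defs.repr D) ->
  cs2 (@induced_le SigmaV SigmaE) C D (iso_class g).
Proof.
by move=> gC gD _ [->|->]; rewrite -[X in induced_le _ X]Defs.reprK;
  apply/induced_le_class.
Qed.

End Embeddings.

(** * Vertex weights and the size function *)

Section Weight.
Variables (R : realType) (SigmaV SigmaE : Type) (alpha : SigmaV -> R).
Hypothesis alpha_gt0 : forall a, 0 < alpha a.
Implicit Types g h : graph SigmaV SigmaE.

(** Subgraphs are measured as vertex sets inside one ambient graph, so that their sizes obey the set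
    algebra of a finite measure. *)
Definition weight g (W : {set vert g}) : R := \sum_(v in W) alpha (vlab v).

Lemma weight_ge0 g (W : {set vert g}) : 0 <= weight W.
Proof. by apply: sumr_ge0 => v _; apply: ltW. Qed.

Lemma graph_sizeE g : graph_size alpha g = weight [set: vert g].
Proof. by apply: eq_bigl => v; rewrite inE. Qed.

Lemma weightID g (A B : {set vert g}) :
  weight A = weight (A :&: B) + weight (A :\: B).
Proof. exact: big_setID. Qed.

Lemma weight_mono g (A B : {set vert g}) : A \subset B -> weight A <= weight B.
Proof.
by move=> /finset.setIidPr sAB; rewrite (weightID B A) sAB lerDl weight_ge0.
Qed.

(** A vertex in [W] would contribute a strictly positive term to a sum of nonnegative ones. *)
Lemma weight_eq0 g (W : {set vert g}) : weight W = 0 -> W = finset.set0.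
Proof.
move=> W0; apply/eqP/set0Pn=> -[v vW]; move: W0; apply/eqP.
rewrite /weight (big_setD1 v) //= gt_eqF // ltr_wpDr //.
exact: (weight_ge0 (W :\ v)).
Qed.

Lemma weight_setUI g (A B : {set vert g}) :
  weight A + weight B - weight (A :&: B) = weight (A :|: B).
Proof.
(* Splitting along [A] leaves the same remainder [B :\: A] in [B] and in the union. *)
rewrite (weightID B A) (weightID (A :|: B) A) finset.setDUl finset.setDv.
rewrite finset.set0U (finset.setIidPr (finset.subsetUl A B)).
by rewrite [weight (B :&: A) + _]addrC addrA finset.setIC addrK.
Qed.

Lemma weight_image g h (f : vert g -> vert h) :
  is_embedding f -> weight (f @: [set: vert g]) = graph_size alpha g.
Proof.
move=> ef; rewrite graph_sizeE /weight big_imset /=; last first.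
  by move=> x y _ _; apply: (embed_inj ef).
by apply: eq_bigr => v _; rewrite (embed_vlab ef).
Qed.

Lemma graph_size_induced g (W : {set vert g}) :
  graph_size alpha (induced W) = weight W.
Proof.
rewrite -(weight_image (embedding_val W)); congr weight.
apply/finset.setP=> x; apply/imsetP/idP=> [[y _ ->]|xW]; first exact: valP y.
by exists (exist _ x xW).
Qed.

Lemma graph_size_sub g h :
  induced_sub g h -> graph_size alpha g <= graph_size alpha h.
Proof.
move=> /induced_subP[f ef]; rewrite -(weight_image ef) graph_sizeE.
exact/weight_mono/finset.subsetT.
Qed.

Lemma graph_size_sub_iso g h :
  induced_sub g h -> graph_size alpha g = graph_size alpha h -> graph_iso g h.
Proof.
move=> /induced_subP[f ef] eq_size; apply: (embedding_iso ef).
(* The image of [f] already carries the whole weight of [h], so nothing is left for its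
   complement. *)
have : weight (~: (f @: [set: vert g])) = 0.
  move: eq_size; rewrite (graph_sizeE h) -(weight_image ef).
  rewrite (weightID [set: vert h] (f @: [set: vert g])).
  by rewrite finset.setTI finset.setTD -{1}[weight _]addr0 => /addrI.
move=> /weight_eq0 im_full.
rewrite -!cardsT -(card_imset [set: vert g] (embed_inj ef)).
by rewrite -[f @: _]finset.setCK im_full finset.setC0.
Qed.

Lemma s_GV_size_function :
  is_size_function (@induced_le SigmaV SigmaE) (@s_GV SigmaV SigmaE R alpha).
Proof.
split.
- by move=> C; rewrite /s_GV graph_sizeE weight_ge0.
- by move=> C D /induced_leE; apply: graph_size_sub.
- move=> C D /induced_leE CD eq_size.
  rewrite -(Defs.reprK C) -(Defs.reprK D); apply/iso_class_eq.
  exact: graph_size_sub_iso CD eq_size.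
Qed.

(** * Largest common subgraphs and overlaps, for (A1) and (A2) *)

Lemma max_common_induced g h :
  exists2 W : {set vert g}, induced_sub (induced W) h &
    forall k, induced_sub k g -> induced_sub k h ->
      graph_size alpha k <= weight W.
Proof.
pose P (W : {set vert g}) := `[< induced_sub (induced W) h >].
have P0 : P finset.set0 by apply/asboolP/induced_set0_sub.
case: (Order.TotalTheory.arg_maxP (@weight g) P0) => W /asboolP PW maxW.
(* Replace [k] by its image in [g]: the weight is the same, and the subgraph spanned by the image
   embeds in [k], hence in [h]. *)
exists W => // k /induced_subP[f ef] kh; rewrite -(weight_image ef).
apply: maxW; apply/asboolP/(induced_sub_trans _ kh).
exact: induced_sub_image ef _.
Qed.

Lemma common_induced_overlap g1 g2 g :
  induced_sub g1 g -> induced_sub g2 g ->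
  exists k, [/\ induced_sub k g1, induced_sub k g2 &
    graph_size alpha g1 + graph_size alpha g2 - graph_size alpha k
      <= graph_size alpha g].
Proof.
move=> /induced_subP[f1 ef1] /induced_subP[f2 ef2].
exists (induced (f1 @: [set: vert g1] :&: f2 @: [set: vert g2])); split.
- exact: induced_sub_image ef1 (finset.subsetIl _ _).
- exact: induced_sub_image ef2 (finset.subsetIr _ _).
- rewrite graph_size_induced -(weight_image ef1) -(weight_image ef2).
  by rewrite weight_setUI graph_sizeE weight_mono // finset.subsetT.
Qed.

End Weight.

Theorem theorem3 (R : realType) (SigmaV SigmaE : Type) (alpha : SigmaV -> R)
    (alpha_gt0 : forall a : SigmaV, 0 < alpha a) :
  MCS_model (@induced_le SigmaV SigmaE) (@s_GV SigmaV SigmaE R alpha).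
Proof.
split.
- exact: induced_le_order.
- exact: s_GV_size_function.
- move=> C D.
  have [W WD maxW] := max_common_induced alpha (Defs.repr C) (Defs.repr D).
  have csW := cs2_iso_class (induced_sub_induced W) WD.
  split; first by exists (iso_class (induced W)).
  exists (weight alpha W).
    exists (iso_class (induced W)) => //.
    by rewrite s_GV_class graph_size_induced.
  (* A lower bound of [C] and [D] is represented by a common induced subgraph of their
     representatives, so the maximality of [W] applies to it. *)
  move=> _ [K csK ->]; apply: maxW; apply/induced_leE/csK; first by left.
  by right.
- move=> C D K /induced_leE CK /induced_leE DK.
  have [k [kC kD le_size]] := common_induced_overlap alpha_gt0 CK DK.
  exists (iso_class k); first exact: cs2_iso_class.
  by rewrite s_GV_class.
Qed.
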